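(* Let $p$ be a prime and let $P$ be a finite $p$-group with $p > f(P)+1$, where $f(P)$ denotes the coexponent of $P$. Then the nilpotency class of $P$ satisfies $\mathrm{cl}(P) \leq f(P)+1$.
   Context: For a finite $p$-group $P$ of order $p^n$ and exponent $p^e$, the coexponent of $P$ is $f(P)=n-e$. $\mathrm{cl}(P)$ denotes the nilpotency class of $P$. *)

(* Defs.v *)
From mathcomp Require Import all_boot all_fingroup all_solvable.

Set Implicit Arguments.
Unset Strict Implicit.
Unset Printing Implicit Defensive.

(* For a p-group A of order p ^ n and exponent p ^ e this is n - e. The natural
   subtraction is not truncated, since the exponent divides the order. *)
Definition coexponent (p : nat) (gT : finGroupType) (A : {set gT}) : nat :=
  logn p #|A| - logn p (exponent A).

Lemma coexponentE (p n e : nat) (gT : finGroupType) (P : {group gT}) :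
    prime p -> #|P| = p ^ n -> exponent P = p ^ e ->
  e <= n /\ coexponent p P = n - e.
Proof.
move=> p_pr oP eP; have := exponent_dvdn P.
by rewrite /coexponent oP eP !pfactorK // dvdn_Pexp2l ?prime_gt1.
Qed.

(* Main.v *)
Require Import Defs.
From mathcomp Require Import all_boot all_fingroup all_solvable.
From mathcomp Require Import zify.

Set Implicit Arguments.
Unset Strict Implicit.
Unset Printing Implicit Defensive.

Import GroupScope.

(** Write f for the coexponent of P, and Mho^1, Ohm_1 for the subgroups
    generated by the p-th powers and by the elements of order p. An element of
    maximal order gives |P : Mho^1(P)| <= p^(f + 1) < p^p, and then the
    Hall-Petrescu formula shows that P is regular (Hall). If P is not cyclic,
    put |P : Mho^1(P)| = p^t, |Ohm_1(P)| = p^k and Q = P / Ohm_1(P). By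
    regularity 2 <= t <= k, and the coexponent of Q is at most f - k + 1, so by
    induction Q has class at most m := f - k + 2. Now L_t(P) <= Mho^1(P), as
    P / Mho^1(P) has order p^t, while [Mho^1(M), P] <= Mho^1([M, P]) for M
    normal in P; hence
    L_(t + m)(P) <= Mho^1(L_(m + 1)(P)) <= Mho^1(Ohm_1(P)) = 1.

    The Hall-Petrescu formula is obtained from Leibman's theorem: sequences in G
    whose k-th differences lie in the k-th term of the lower central series are
    closed under products. *)

(** * Commutators of lower central terms *)

Lemma three_subgroup_sub (gT : finGroupType) (N G H K : {group gT}) :
    G \subset 'N(N) -> H \subset 'N(N) -> K \subset 'N(N) ->
    [~: G, H, K] \subset N -> [~: H, K, G] \subset N ->
  [~: K, G, H] \subset N.
Proof.
move=> nNG nNH nNK sGHK sHKG.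
have R3 (A B C : {group gT}) :
    A \subset 'N(N) -> B \subset 'N(N) -> C \subset 'N(N) ->
  [~: A / N, B / N, C / N] = [~: A, B, C] / N.
  by move=> nA nB nC; rewrite !quotientR ?comm_subG.
rewrite -quotient_sub1 ?comm_subG // -R3 // subG1; apply/eqP.
by apply: three_subgroup; rewrite /= R3 //; apply: quotientS1.
Qed.

Lemma commg_lcn (gT : finGroupType) (G : {group gT}) i j :
  [~: 'L_i(G), 'L_j(G)] \subset 'L_(i + j)(G).
Proof.
case: j => [|j]; first by rewrite lcn0 addn0 commg_subl lcn_norm.
elim: j i => [|j IHj] i; first by rewrite lcn1 addn1 lcnSnS.
rewrite lcnSn commGC addnS.
have nL := lcn_norm (i + j.+1).+1 G.
have nLs n : 'L_n(G) \subset 'N('L_(i + j.+1).+1(G)).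
  exact: subset_trans (lcn_sub n G) nL.
apply: (three_subgroup_sub (H := 'L_i(G)) (G := G) (K := 'L_j.+1(G))) => //=.
  by rewrite -addSn (subset_trans _ (IHj i.+1)) // commSg // commGC lcnSnS.
by apply: subset_trans (lcnSnS _ G); rewrite commSg.
Qed.

(** The increment of a commutator sequence: up to conjugacy, each factor on the right is a
    commutator involving [u] or [v], hence lies deeper when these are increments. *)
Lemma comm_diff (gT : finGroupType) (a b u v : gT) :
  [~ a, b]^-1 * [~ a * u, b * v] =
    ([~ a, v] ^ u) ^ [~ a, b] * [~ [~ a, b], v * u]
      * ([~ u, v] * [~ u, b] ^ v).
Proof.
by rewrite /commg /conjg !invMg !invgK !mulgA !(mulgK, mulgKV).
Qed.

(** * Polynomial sequences and the Hall-Petrescu formula *)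

Section PolynomialSequences.

Variables (gT : finGroupType) (G : {group gT}).
Implicit Types (g h u v w : nat -> gT) (r d : nat).

Definition fwd_diff g n := (g n)^-1 * g n.+1.

(* Sequences whose k-th difference takes values in 'L_(d + k)(G), for k < r;
   truncating at r makes the closure properties provable by induction on r. *)
Fixpoint poly_seq r d g : Prop :=
  if r is r'.+1 then
    (forall n, g n \in 'L_d(G)) /\ poly_seq r' d.+1 (fwd_diff g)
  else True.

Lemma eq_poly_seq r d g h : g =1 h -> poly_seq r d g -> poly_seq r d h.
Proof.
elim: r d g h => //= r IHr d g h eqgh [Lg Dg].
split=> [n|]; first by rewrite -eqgh.
by apply: IHr Dg => n; rewrite /fwd_diff !eqgh.
Qed.

Lemma poly_seqS r d g : poly_seq r.+1 d g -> poly_seq r d g.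
Proof.
elim: r d g => // r IHr d g [Lg Dg]; split=> //; exact: IHr.
Qed.

Lemma poly_seq_leq r d d' g : d' <= d -> poly_seq r d g -> poly_seq r d' g.
Proof.
elim: r d d' g => //= r IHr d d' g led [Lg Dg].
split; last exact: IHr Dg.
by move=> n; apply: subsetP (Lg n); apply: lcn_sub_leq.
Qed.

Lemma poly_seq1 r d : poly_seq r d (fun=> 1).
Proof.
elim: r d => //= r IHr d; split=> //.
by apply: eq_poly_seq (IHr _) => n; rewrite /fwd_diff mulg1 invg1.
Qed.

(** The induction on [r] must be joint: differencing a product creates conjugates, hence
    commutators, and differencing a commutator creates products. *)
Lemma poly_seq_closed r :
    (forall d g h, poly_seq r d g -> poly_seq r d h ->
       poly_seq r d (fun n => g n * h n))
  /\ (forall i j g h, poly_seq r i g -> poly_seq r j h ->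
       poly_seq r (i + j) (fun n => [~ g n, h n])).
Proof.
elim: r => // r [IHM IHR].
have conjP i w x : poly_seq r i w -> poly_seq r 0 x ->
  poly_seq r i (fun n => w n ^ x n).
  move=> Pw Px; apply: eq_poly_seq (IHM i _ _ Pw _).
    by move=> n; rewrite conjg_mulR.
  by rewrite -[i]addn0; apply: IHR.
have w0 i w : poly_seq r i w -> poly_seq r 0 w by apply: poly_seq_leq.
split=> [d g h /[dup] /poly_seqS Pg [Lg Dg] /[dup] /poly_seqS Ph [Lh Dh] |
  i j g h /[dup] /poly_seqS Pg [Lg Dg] /[dup] /poly_seqS Ph [Lh Dh]].
  split=> [n|]; first exact: groupM.
  have := IHM _ _ _ (conjP _ _ _ Dg (w0 _ _ Ph)) Dh.
  apply: eq_poly_seq => n; rewrite /fwd_diff conjgE !mulgA.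
  by rewrite mulgK invMg.
split=> [n|]; first by apply: subsetP (commg_lcn _ _ _) _ _; apply: mem_commg.
pose u := fwd_diff g; pose v := fwd_diff h; pose c n := [~ g n, h n].
have Pc : poly_seq r (i + j) c by apply: IHR.
have c1 : poly_seq r (i + j).+1 (fun n => [~ g n, v n]).
  by rewrite -addnS; apply: IHR.
have c2 : poly_seq r (i + j).+1 (fun n => [~ u n, h n]).
  by rewrite -addSn; apply: IHR.
have c3 : poly_seq r (i + j).+1 (fun n => [~ u n, v n]).
  by apply: (@poly_seq_leq _ (i.+1 + j.+1)); [rewrite addSn addnS | apply: IHR].
(* Degree 1 for [v n * u n] suffices, as [c] already has degree [i + j]. *)
have c4 : poly_seq r (i + j).+1 (fun n => [~ c n, v n * u n]).
  rewrite -addn1; apply: IHR => //.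
  by apply: IHM; [apply: poly_seq_leq Dh | apply: poly_seq_leq Dg].
have c5 := conjP _ _ _ (conjP _ _ _ c1 (w0 _ _ Dg)) (w0 _ _ Pc).
have c6 := conjP _ _ _ c2 (w0 _ _ Dh).
have := IHM _ _ _ (IHM _ _ _ c5 c4) (IHM _ _ _ c3 c6).
apply: eq_poly_seq => n.
have gE : g n.+1 = g n * u n by rewrite mulKVg.
have hE : h n.+1 = h n * v n by rewrite mulKVg.
by rewrite [RHS]/fwd_diff gE hE comm_diff.
Qed.

Lemma poly_seqM r d g h :
  poly_seq r d g -> poly_seq r d h -> poly_seq r d (fun n => g n * h n).
Proof. by case: (poly_seq_closed r) => + _; apply. Qed.

Lemma poly_seq_bin r d k a :
  a \in 'L_(d + k)(G) -> poly_seq r d (fun n => a ^+ 'C(n, k)).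
Proof.
elim: r d k => //= r IHr d k La; split=> [n|].
  by apply: groupX; apply: subsetP La; rewrite lcn_sub_leq ?leq_addr.
case: k La => [|k] La.
  apply: eq_poly_seq (poly_seq1 _ _) => n.
  by rewrite /fwd_diff !bin0 mulVg.
apply: eq_poly_seq (IHr _ k _); last by rewrite addSnnS.
by move=> n; rewrite /fwd_diff binS expgD mulKg.
Qed.

(** Values below [k] being trivial, the [k]-th difference at 0 is [g k]. *)
Lemma poly_seq_first r d k g :
    poly_seq r d g -> k < r -> (forall n, n < k -> g n = 1) ->
  g k \in 'L_(d + k)(G).
Proof.
elim: r d k g => // r IHr d [|k] g [Lg Dg] ltkr g1; first by rewrite addn0.
have -> : g k.+1 = fwd_diff g k by rewrite /fwd_diff (g1 k) // invg1 mul1g.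
rewrite -addSnnS; apply: IHr => // n ltnk.
by rewrite /fwd_diff !g1 ?invg1 ?mulg1 // ltnW.
Qed.

(** Newton coefficients are removed one at a time: dividing by [a ^+ 'C(n, k)] with [a = g k] kills
    the value at [k], and for [k < p] changes the value at [p] only by an element of [N], since [p]
    divides ['C(p, k)]. *)
Lemma poly_seq_prime (p k : nat) (N : {group gT}) g :
    prime p -> 1 < k <= p -> 'L_p(G) \subset N ->
    (forall a, a \in 'L_2(G) -> a ^+ p \in N) ->
    poly_seq p.+1 0 g -> (forall n, n < k -> g n = 1) ->
  g p \in N.
Proof.
move=> p_pr + sLN sXN; move Dm: (p - k) => m.
elim: m k g Dm => [|m IHm] k g Dm /andP[k_gt1 lekp] Pg g1.
  have kp : k = p by apply/eqP; rewrite eqn_leq lekp -subn_eq0 Dm.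
  by apply: (subsetP sLN); apply: (poly_seq_first Pg); rewrite // -kp.
have ltkp : k < p by rewrite -subn_gt0 Dm.
pose a := g k.
have La : a \in 'L_k(G) by apply: (poly_seq_first Pg) => //; apply: ltnW.
pose g' n := (a^-1) ^+ 'C(n, k) * g n.
have g'1 n : n < k.+1 -> g' n = 1.
  rewrite ltnS leq_eqVlt => /predU1P[->|ltnk]; first by rewrite /g' binn mulVg.
  by rewrite /g' bin_small // g1 // mulg1.
have Ng' : g' p \in N.
  apply: (IHm k.+1); rewrite ?subnS ?Dm //; first by rewrite ltnW.
  by apply: (poly_seqM _ Pg); apply: poly_seq_bin; rewrite groupV.
rewrite -[g p](mulKg (a^-1 ^+ 'C(p, k))); rewrite groupM // groupV.
have /dvdnP[q ->] : p %| 'C(p, k).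
  by rewrite prime_dvd_bin // ltkp (ltn_trans _ k_gt1).
rewrite mulnC expgM groupX // sXN // groupV.
by apply: subsetP La; apply: lcn_sub_leq.
Qed.

(* n |-> y^-n x^-n (xy)^n is a polynomial sequence, trivial at n = 0 and n = 1;
   its Newton expansion at p consists of powers a^C(p, k) with a in L_k(G) and
   1 < k < p, and of an element of L_p(G). *)
Lemma Hall_Petrescu (p : nat) (N : {group gT}) x y :
    prime p -> 'L_p(G) \subset N ->
    (forall a, a \in 'L_2(G) -> a ^+ p \in N) ->
    x \in G -> y \in G ->
  y ^- p * x ^- p * (x * y) ^+ p \in N.
Proof.
move=> p_pr sLN sXN Gx Gy.
have Pexp r a : a \in G -> poly_seq r 0 (fun n => a ^+ n).
  move=> Ga; apply: eq_poly_seq (poly_seq_bin (k := 1) _ _); last exact: Ga.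
  by move=> n; rewrite bin1.
rewrite -!expgVn.
pose g n := y^-1 ^+ n * x^-1 ^+ n * (x * y) ^+ n.
apply: (@poly_seq_prime p 2 N g) => //.
- exact: prime_gt1.
- apply: poly_seqM; last by apply: Pexp; rewrite groupM.
  by apply: poly_seqM; apply: Pexp; rewrite groupV.
rewrite /g; case=> [|[|]] // _; first by rewrite !expg0 !mulg1.
by rewrite !expg1 -!mulgA mulKg mulVg.
Qed.

End PolynomialSequences.

(** * Coexponent, ['Mho^1(P)] and the lower central series *)

Section Preliminaries.

Variables (gT : finGroupType) (p : nat).
Hypothesis p_pr : prime p.
Implicit Types (G H K M N P : {group gT}) (x y c : gT).

Lemma der1_join_cycles_sub x c N :
    x \in 'N(N) -> c \in 'N(N) -> [~ x, c] \in N ->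
  (<[x]> <*> <[c]>)^`(1) \subset N.
Proof.
move=> nNx nNc Nxc.
have sxN : <[x]> \subset 'N(N) by rewrite cycle_subG.
have scN : <[c]> \subset 'N(N) by rewrite cycle_subG.
rewrite der1_min ?join_subG ?sxN //= quotientY // !quotient_cycle //.
rewrite abelianY !cycle_abelian /=; apply: cents_cycle; apply/esym/commgP.
by rewrite -morphR //= coset_id.
Qed.

(* In this restatement #|P| is elaborated along the coercion path used by the
   rest of the file, so that lia identifies the two cardinals. *)
Lemma coexponent_logn P :
  coexponent p P = logn p #|P| - logn p (exponent P).
Proof. by []. Qed.

Lemma commg_Mho1_sub M P N :
    p.-group M -> M \subset 'N(N) -> P \subset 'N(N) ->
    {in M & P, forall x y, [~ x ^+ p, y] \in N} ->
  [~: 'Mho^1(M), P] \subset N.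
Proof.
move=> pM nNM nNP sRN; rewrite -quotient_cents2 ?gFsub_trans //.
rewrite (MhoE 1 pM) expn1 quotient_gen; last first.
  by apply/subsetP=> _ /imsetP[x Mx ->]; rewrite groupX // (subsetP nNM).
rewrite gen_subG; apply/subsetP=> _ /morphimP[z nNz /imsetP[x Mx Dz] ->].
rewrite {z}Dz in nNz *.
apply/centP=> _ /morphimP[y nNy Py ->]; apply/commgP.
by rewrite -morphR //= coset_id ?sRN.
Qed.

(** As [x ^ y = x * [~ x, y]], Hall-Petrescu for [x] and [[~ x, y]] compares [[~ x ^+ p, y]] with
    [[~ x, y] ^+ p]. *)
Lemma commg_expn_mem x y N (K := (<[x]> <*> <[[~ x, y]]>)%G) :
    'L_p(K) \subset N -> {in 'L_2(K), forall a, a ^+ p \in N} ->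
  [~ x, y] ^+ p \in N -> [~ x ^+ p, y] \in N.
Proof.
move=> sLN sXN Ncp; have Kx : x \in K by rewrite mem_gen // inE cycle_id.
have Kc : [~ x, y] \in K by rewrite mem_gen // inE cycle_id orbT.
have := Hall_Petrescu p_pr sLN sXN Kx Kc.
by rewrite -conjg_mulR -conjXg -mulgA groupMl ?groupV // commgEl.
Qed.

(** For [x] of maximal order in [P], the index of [H :&: <[x]>] in [H] is at most that of [<[x]>] in
    [P], and the order of this cyclic group divides the exponent of [H]. *)
Lemma coexponentS P H :
  p.-group P -> H \subset P -> coexponent p H <= coexponent p P.
Proof.
move=> pP sHP; have pH := pgroupS sHP pP.
have [x Px oP] := exponent_witness (pgroup_nil pP).
have le_lg : logn p #|H| + logn p #[x] <= logn p #|P| + logn p #|H :&: <[x]>|.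
  have pI : p.-group (H :&: <[x]>) := pgroupS (subsetIl _ _) pH.
  rewrite -(leq_exp2l _ _ (prime_gt1 p_pr)) !expnD -!card_pgroup //; last first.
    exact: mem_p_elt Px.
  rewrite mul_cardG leq_mul2r subset_leq_card ?orbT //.
  by rewrite mul_subG ?cycle_subG.
have le_exp : logn p #|H :&: <[x]>| <= logn p (exponent H).
  rewrite dvdn_leq_log ?exponent_gt0 //.
  rewrite -exponent_cyclic ?exponentS ?subsetIl //.
  by rewrite (cyclicS (subsetIr _ _)) ?cycle_cyclic.
have : logn p #[x] <= logn p #|P| by rewrite -oP dvdn_leq_log ?exponent_dvdn.
by rewrite !coexponent_logn oP; lia.
Qed.

Lemma index_Mho1_coexponent P :
  p.-group P -> logn p #|P : 'Mho^1(P)| <= (coexponent p P).+1.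
Proof.
move=> pP; have [x Px oP] := exponent_witness (pgroup_nil pP).
have Mxp : x ^+ p \in 'Mho^1(P).
  by apply: (Mho_p_elt 1); rewrite ?(mem_p_elt pP).
rewrite -divgS ?Mho_sub // logn_div ?cardSg ?Mho_sub //.
rewrite coexponent_logn oP -subSn; last first.
  by rewrite -oP dvdn_leq_log ?exponent_dvdn.
have : logn p #[x] <= (logn p #|'Mho^1(P)|).+1.
  apply: (@leq_trans (logn p #[x ^+ p]).+1).
    rewrite -add1n.
    have <- : logn p (p * #[x ^+ p]) = (1 + logn p #[x ^+ p])%N.
      by rewrite lognM ?(prime_gt0 p_pr) // logn_prime // eqxx.
    rewrite dvdn_leq_log ?muln_gt0 ?(prime_gt0 p_pr) ?order_gt0 //.
    by rewrite order_dvdn expgM expg_order.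
  by rewrite ltnS dvdn_leq_log // order_dvdG.
rewrite /=; lia.
Qed.

Lemma lcn_index_Mho1 P (t := logn p #|P : 'Mho^1(P)|) :
  p.-group P -> ~~ cyclic P -> 1 < t /\ 'L_t(P) \subset 'Mho^1(P).
Proof.
move=> pP ncP; have nM : P \subset 'N('Mho^1(P)) := gFnorm _ _.
have pQ : p.-group (P / 'Mho^1(P)) by apply: quotient_pgroup.
have oQ : #|P / 'Mho^1(P)| = (p ^ t)%N.
  by rewrite (card_pgroup pQ) card_quotient.
(* Otherwise [P / 'Mho^1(P)] is cyclic, so ['Mho^1(P)] is the Frattini subgroup and [P] is
   cyclic. *)
have t_gt1 : 1 < t.
  rewrite ltnNge; apply: contra ncP => le_t1.
  have cQ : cyclic (P / 'Mho^1(P)).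
    case: (t) le_t1 oQ => [|[|]] // _ oQ.
      by rewrite (card1_trivg oQ) cyclic1.
    by rewrite prime_cyclic ?oQ ?expn1.
  apply: Phi_quotient_cyclic; rewrite (Phi_joing pP).
  by rewrite (joing_idPr (der1_min nM (cyclic_abelian cQ))).
split=> //; rewrite -quotient_sub1 ?(subset_trans (lcn_sub _ _)) //.
rewrite /quotient morphim_lcn // -quotientE.
rewrite -(prednK (ltnW t_gt1)).
have clQ : nil_class (P / 'Mho^1(P)) <= t.-1.
  by apply: leq_trans (nil_class_pgroup pQ) _; rewrite oQ pfactorK //; lia.
by rewrite (lcn_nil_classP _ (pgroup_nil pQ) clQ).
Qed.

(** For [P] not cyclic, [t <= p - 1] puts ['L_p(P)] inside [[~: 'Mho^1(P), P]], which lies in the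
    product of ['Mho^1('L_2(P))] and ['L_p.+1(P)]; nilpotency removes the second factor. *)
Lemma lcn_sub_Mho1 P :
  p.-group P -> coexponent p P + 1 < p -> 'L_p(P) \subset 'Mho^1('L_2(P)).
Proof.
move=> pP ltfp; have p_gt1 := prime_gt1 p_pr.
have [cycP | ncP] := boolP (cyclic P).
  apply: subset_trans (lcn_sub_leq P p_gt1) _.
  by rewrite lcn2 derg1 (commG1P (cyclic_abelian cycP)) sub1G.
have [t_gt1 sLM] := lcn_index_Mho1 pP ncP.
have le_tf := index_Mho1_coexponent pP.
pose N := ('Mho^1('L_2(P)) <*> 'L_p.+1(P))%G.
have nN1 : P \subset 'N('Mho^1('L_2(P))) by rewrite !gFnorm_trans.
have nN : P \subset 'N(N) by rewrite normsY // lcn_norm.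
have sMN : [~: 'Mho^1(P), P] \subset N.
  apply: commg_Mho1_sub => // x y Px Py; set c := [~ x, y].
  have L2c : c \in 'L_2(P) by apply: mem_commg.
  pose K := (<[x]> <*> <[c]>)%G.
  have sKP : K \subset P by rewrite join_subG !cycle_subG Px groupR.
  have sXN a : a \in 'L_2(P) -> a ^+ p \in N.
    move=> La; rewrite mem_gen // inE (Mho_p_elt 1) //.
    exact: mem_p_elt (pgroupS (lcn_sub _ _) pP) La.
  apply: commg_expn_mem; last exact: sXN.
    (* The derived subgroup of [K] lies in ['L_3(P)], so ['L_n(K)] lies in ['L_n.+1(P)] for
       [n >= 2]. *)
    apply: subset_trans (joing_subr _ _).
    elim: (p) p_gt1 => // -[|[_ _|n IHn _]] //.
      have nL3 := subsetP (lcn_norm 3 P).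
      apply: der1_join_cycles_sub.
      - exact: nL3.
      - by rewrite nL3 ?groupR.
      by rewrite -invg_comm groupV mem_commg.
    by rewrite lcnSn (lcnSn n.+2) commgSS ?IHn.
  by move=> a La; apply: sXN; apply: (subsetP (lcnS 2 sKP)).
have sLN : 'L_p(P) \subset N.
  apply: subset_trans sMN; have -> : p = p.-2.+2 by lia.
  rewrite lcnSn commSg // (subset_trans _ sLM) // lcn_sub_leq //; lia.
have nilQ : nilpotent (P / 'Mho^1('L_2(P))).
  by rewrite quotient_nil ?(pgroup_nil pP).
rewrite -quotient_sub1 ?(subset_trans (lcn_sub _ _)) // subG1.
have pE : p = p.-1.+1 by lia.
(* In a nilpotent group, a subgroup contained in its commutator with the whole group is trivial. *)
apply: (forall_inP nilQ); rewrite subsetI quotientS ?lcn_sub //=.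
rewrite -quotientR ?(subset_trans (lcn_sub _ _)) //.
rewrite [X in [~: 'L_X(P), P]]pE -lcnSn -pE.
rewrite -(quotientYidl (G := 'L_p.+1(P))); first exact: quotientS.
exact: subset_trans (lcn_sub _ _) nN1.
Qed.

End Preliminaries.

(** * Regular p-groups *)

Section Regular.

Variables (gT : finGroupType) (p : nat).
Hypothesis p_pr : prime p.
Implicit Types (G H M N P : {group gT}) (x y c : gT).

(* Equivalent to P. Hall's definition: the usual one only takes H = <x, y>. *)
Definition regular_pgroup P := forall H x y,
  H \subset P -> x \in H -> y \in H ->
  y ^- p * x ^- p * (x * y) ^+ p \in 'Mho^1(H^`(1)).

(** Subgroups inherit the bound by monotonicity of the coexponent, so Hall-Petrescu applies inside
    [H]. *)
Lemma coexponent_regular P :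
  p.-group P -> coexponent p P + 1 < p -> regular_pgroup P.
Proof.
move=> pP ltfp H x y sHP Hx Hy; have pH := pgroupS sHP pP.
have ltfpH : coexponent p H + 1 < p.
  by apply: leq_ltn_trans ltfp; rewrite leq_add2r coexponentS.
apply: (Hall_Petrescu (N := 'Mho^1(H^`(1))%G) p_pr) Hx Hy.
  exact: lcn_sub_Mho1.
move=> a La; apply: (Mho_p_elt 1 La).
exact: mem_p_elt (pgroupS (lcn_sub _ _) pH) La.
Qed.

Lemma regular_commg_Mho1 P M :
    p.-group P -> regular_pgroup P -> M <| P ->
  [~: 'Mho^1(M), P] \subset 'Mho^1([~: M, P]).
Proof.
move=> pP regP /andP[sMP nMP]; have pM := pgroupS sMP pP.
have nRP : P \subset 'N([~: M, P]) by rewrite commg_normr.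
have nNP : P \subset 'N('Mho^1([~: M, P])) by rewrite gFnorm_trans.
have pR : p.-group [~: M, P] by apply: pgroupS pM; rewrite commg_subl.
apply: (commg_Mho1_sub (N := 'Mho^1([~: M, P])%G) pM) => //.
  exact: subset_trans nNP.
move=> x y Mx Py; set c := [~ x, y]; have Px := subsetP sMP x Mx.
have Rc : c \in [~: M, P] by apply: mem_commg.
pose K := (<[x]> <*> <[c]>)%G.
have sKP : K \subset P by rewrite join_subG !cycle_subG Px groupR.
have Kx : x \in K by rewrite mem_gen // inE cycle_id.
have Kc : c \in K by rewrite mem_gen // inE cycle_id orbT.
have := regP K x c sKP Kx Kc.
rewrite -conjg_mulR -conjXg -mulgA -commgEl => HK.
rewrite -(groupMl (G := 'Mho^1([~: M, P])%G) _ (x := c ^- p)).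
  apply: subsetP HK; apply: MhoS; apply: der1_join_cycles_sub.
  - by rewrite (subsetP nRP).
  - by rewrite (subsetP nRP) ?groupR.
  by rewrite mem_commg // groupR.
rewrite groupV (Mho_p_elt 1) //; exact: mem_p_elt Rc.
Qed.

Lemma exponent_gen P (X : {set gT}) :
    p.-group P -> <<X>> = P ->
    {in X, forall x, x ^+ p = 1} ->
    {in P &, forall x y, x ^+ p = 1 -> y ^+ p = 1 -> (x * y) ^+ p = 1} ->
  exponent P %| p.
Proof.
move=> pP <- X1 XM; apply/exponentP=> x /gen_prodgP[n [c Xc ->]].
suffices [] : \prod_(i < n) c i \in <<X>> /\ (\prod_(i < n) c i) ^+ p = 1 by [].
elim/big_rec: _ => [|i x' _ [Xx' x'1]]; first by rewrite group1 expg1n.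
have Xi : c i \in <<X>> by rewrite mem_gen.
by split; [rewrite groupM | rewrite XM // X1].
Qed.

Lemma Mho1_exponent P : p.-group P -> exponent P %| p -> 'Mho^1(P) = 1.
Proof.
move=> pP eP; apply/trivgP; rewrite /= (MhoE 1 pP) gen_subG.
apply/subsetP=> _ /imsetP[x Px ->]; apply/set1P.
by apply/eqP; rewrite -order_dvdn (dvdn_trans (dvdn_exponent Px)) ?expn1.
Qed.

(** The derived subgroup lies in ['Phi(P)], which consists of non-generators. *)
Lemma proper_join_cycle_der1 P x :
  p.-group P -> ~~ cyclic P -> x \in P -> <[x]> <*> P^`(1) \proper P.
Proof.
move=> pP ncP Px; rewrite properEneq join_subG cycle_subG Px der_sub !andbT.
apply: contra ncP => /eqP DP; apply/cyclicP; exists x; apply/esym/Phi_nongen.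
apply/eqP; rewrite eqEsubset join_subG Phi_sub sub1set Px /=.
rewrite -{1}DP join_subG cycle_subG mem_gen ?inE ?eqxx ?orbT //=.
by rewrite sub_gen // subsetU // (Phi_joing pP) joing_subl.
Qed.

(* In H = <x, y> the element x^p is central, so x and its conjugates have the
   same p-th power; they lie in the proper subgroup <x>H', so by induction
   [x, h]^p = 1, and then H' has exponent p. *)
Lemma regular_eq_expg P x y :
    p.-group P -> regular_pgroup P -> x \in P -> y \in P ->
  x ^+ p = y ^+ p -> (x^-1 * y) ^+ p = 1.
Proof.
move=> pP regP; have [m] := ubnP #|<[x]> <*> <[y]>|.
elim: m x y => // m IHm x y leHm Px Py xyp; pose H := (<[x]> <*> <[y]>)%G.
have {}leHm : #|H| <= m := leHm.
have sHP : H \subset P by rewrite join_subG !cycle_subG Px.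
have pH := pgroupS sHP pP.
have Hx : x \in H by rewrite mem_gen // inE cycle_id.
have Hy : y \in H by rewrite mem_gen // inE cycle_id orbT.
have [abH | nabH] := boolP (abelian H).
  rewrite expgMn ?expgVn ?xyp ?mulVg //.
  by apply: (centsP abH); rewrite ?groupV.
have ncH : ~~ cyclic H by apply: contra nabH; apply: cyclic_abelian.
have IH (N : {group gT}) a b : N \proper H -> a \in N -> b \in N ->
  a ^+ p = b ^+ p -> (a^-1 * b) ^+ p = 1.
- move=> ltNH Na Nb; have sNP := subset_trans (proper_sub ltNH) sHP.
  apply: IHm; rewrite ?(subsetP sNP) //.
  apply: leq_trans leHm; apply: leq_ltn_trans (proper_card ltNH).
  by rewrite subset_leq_card // join_subG !cycle_subG Na.
have Zxp : x ^+ p \in 'C(H).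
  rewrite centY !cent_cycle inE; apply/andP; split; apply/cent1P/commute_sym.
    exact: commuteX.
  by rewrite xyp; apply: commuteX.
have Rp h : h \in H -> [~ x, h] ^+ p = 1.
  move=> Hh; rewrite commgEl.
  apply: (IH _ _ _ (proper_join_cycle_der1 pH ncH Hx)).
  - by rewrite mem_gen // inE cycle_id.
  - rewrite conjg_mulR groupM ?mem_gen ?inE ?cycle_id //.
    by rewrite mem_commg ?orbT.
  by rewrite -conjXg /conjg (centP Zxp) // mulKg.
(* This class generates the derived subgroup, since [x] and [y] commute modulo its span. *)
pose X := [~ x, y] ^: H.
have sXH' : <<X>> \subset H^`(1).
  by rewrite gen_subG class_sub_norm ?der_norm // mem_commg.
have nXH : H \subset 'N(<<X>>) by rewrite norms_gen // class_norm.
have eX : exponent <<X>> %| p.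
  apply: (@exponent_gen _ X) => //.
  - exact: pgroupS (subset_trans sXH' (der_sub _ _)) pH.
  - by move=> _ /imsetP[h Hh ->]; rewrite -conjXg Rp ?conj1g.
  move=> a b Xa Xb a1 b1; rewrite -[a]invgK; apply: (IH H^`(1)%G).
  - apply: sub_proper_trans (proper_join_cycle_der1 pH ncH Hx).
    exact: joing_subr.
  - by rewrite groupV (subsetP sXH').
  - exact: (subsetP sXH').
  by rewrite expgVn a1 b1 invg1.
have sH'X : H^`(1) \subset <<X>>.
  apply: der1_join_cycles_sub; rewrite ?(subsetP nXH) //.
  by rewrite mem_gen // class_refl.
have Hx' : x^-1 \in H by rewrite groupV.
have := regP H _ _ sHP Hx' Hy.
rewrite Mho1_exponent ?(pgroupS (der_sub _ _) pH) //; last first.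
  exact: dvdn_trans (exponentS sH'X) eX.
by rewrite expgVn invgK xyp mulVg mul1g => /set1P.
Qed.

Lemma regular_Ohm1 P :
  p.-group P -> regular_pgroup P -> exponent 'Ohm_1(P) %| p.
Proof.
move=> pP regP; apply: (exponent_gen (X := 'Ldiv_(p ^ 1)(P))).
- exact: pgroupS (Ohm_sub _ _) pP.
- exact: esym (OhmE 1 pP).
- by move=> x /LdivP[_]; rewrite expn1.
move=> x y Ox Oy x1 y1; rewrite -[x]invgK.
apply: (regular_eq_expg pP regP).
- by rewrite groupV (subsetP (Ohm_sub 1 P)).
- exact: (subsetP (Ohm_sub 1 P)).
by rewrite expgVn x1 y1 invg1.
Qed.

(** Elements with equal [p]-th powers share a right coset of ['Ohm_1(P)], so there are at most as
    many cosets as elements of ['Mho^1(P)]. *)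
Lemma regular_index_Mho1 P :
  p.-group P -> regular_pgroup P -> #|P : 'Mho^1(P)| <= #|'Ohm_1(P)|.
Proof.
move=> pP regP; have sOP := Ohm_sub 1 P.
rewrite -(leq_pmul2l (cardG_gt0 'Mho^1(P))) Lagrange ?Mho_sub //.
rewrite mulnC -(Lagrange sOP) leq_pmul2l ?cardG_gt0 //.
have reprP A : A \in rcosets 'Ohm_1(P) P -> repr A \in P.
  case/rcosetsP=> x Px ->; apply: subsetP (mem_repr_rcoset _ x).
  by rewrite mul_subG // sub1set.
have injX : {in rcosets 'Ohm_1(P) P &, injective (fun A => repr A ^+ p)}.
  move=> A B PA PB /= eqAB; have [Pa Pb] := (reprP A PA, reprP B PB).
  have Oab : repr A * (repr B)^-1 \in 'Ohm_1(P).
    rewrite -[X in X * _]invgK (OhmE 1 pP) mem_gen // !inE expn1.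
    rewrite !(groupM, groupV) //=; apply/eqP.
    by apply: (regular_eq_expg pP regP); rewrite ?groupV // !expgVn eqAB.
  case/rcosetsP: PA PB eqAB Pa Oab => a _ -> /rcosetsP[b _ ->] _ _ Oab.
  rewrite -(rcoset_repr _ a) -(rcoset_repr _ b); apply/rcoset_eqP.
  by rewrite mem_rcoset.
rewrite /indexg -(card_in_imset injX) subset_leq_card //.
apply/subsetP=> _ /imsetP[A PA ->]; apply: (Mho_p_elt 1) (reprP A PA) _.
exact: mem_p_elt pP (reprP A PA).
Qed.

End Regular.

(** * Induction on the order of [P] *)

Lemma nil_class_coexponent (p m : nat) (gT : finGroupType) (P : {group gT}) :
    prime p -> p.-group P -> #|P| <= m -> coexponent p P + 1 < p ->
  nil_class P <= coexponent p P + 1.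
Proof.
(* [gT] is generalised because the quotient [Q] lives in another type. *)
move=> p_pr; elim: m gT P => [|m IHm] gT P pP leP ltfp.
  by rewrite leqNgt cardG_gt0 in leP.
have [cycP | ncP] := boolP (cyclic P).
  by rewrite (leq_trans _ (leq_addl _ _)) // nil_class1 cyclic_abelian.
have regP := coexponent_regular p_pr pP ltfp.
have [t_gt1 sLM] := lcn_index_Mho1 p_pr pP ncP.
set t := logn p _ in t_gt1 sLM.
have eO := regular_Ohm1 pP regP.
have sOP := Ohm_sub 1 P; have pO := pgroupS sOP pP.
have nOP : P \subset 'N('Ohm_1(P)) := gFnorm _ _.
pose k := logn p #|'Ohm_1(P)|.
have le_tk : t <= k.
  rewrite -(leq_exp2l _ _ (prime_gt1 p_pr)) -card_pgroup //.
  apply: leq_trans (regular_index_Mho1 pP regP).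
  have nM : P \subset 'N('Mho^1(P)) := gFnorm _ _.
  by rewrite /t -card_quotient // -card_pgroup ?quotient_pgroup.
have k_gt0 : 0 < k by apply: leq_trans le_tk; apply: ltnW.
pose Q := (P / 'Ohm_1(P))%G.
have pQ : p.-group Q by apply: quotient_pgroup.
have lQ : logn p #|P| = (k + logn p #|Q|)%N.
  by rewrite -(Lagrange sOP) lognM // card_quotient.
have eQ : logn p (exponent P) <= (logn p (exponent Q)).+1.
  have <- : logn p (p * exponent Q) = (logn p (exponent Q)).+1.
    by rewrite lognM ?(prime_gt0 p_pr) ?exponent_gt0 // logn_prime // eqxx.
  rewrite dvdn_leq_log ?muln_gt0 ?(prime_gt0 p_pr) ?exponent_gt0 //.
  (* [y ^+ exponent Q] lies in ['Ohm_1(P)], whose exponent divides [p]. *)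
  apply/exponentP=> y Py; rewrite mulnC expgM.
  apply: (exponentP eO); apply: coset_idr.
    by rewrite groupX // (subsetP nOP).
  by rewrite morphX ?(subsetP nOP) //= expg_exponent ?mem_quotient.
have fQ : coexponent p Q + k <= coexponent p P + 1.
  have : logn p (exponent Q) <= logn p #|Q|.
    by rewrite dvdn_leq_log ?exponent_dvdn.
  have : logn p (exponent P) <= logn p #|P|.
    by rewrite dvdn_leq_log ?exponent_dvdn.
  by rewrite !coexponent_logn; move: eQ lQ; clear; lia.
have ltQP : #|Q| < #|P|.
  rewrite ltn_quotient //; apply: contraTneq k_gt0 => O1.
  by rewrite /k O1 cards1 logn1.
have clQ : nil_class Q <= coexponent p Q + 1.
  by apply: IHm => //; [move: leP ltQP | move: fQ k_gt0 ltfp]; clear; lia.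
set c := (coexponent p Q + 1)%N in clQ.
have LO : 'L_c.+1(P) \subset 'Ohm_1(P).
  rewrite -quotient_sub1 ?(subset_trans (lcn_sub _ _)) //.
  rewrite /quotient morphim_lcn // -quotientE.
  by rewrite (lcn_nil_classP _ (pgroup_nil pQ) clQ).
have LM i : 'L_(t + i)(P) \subset 'Mho^1('L_i.+1(P)).
  elim: i => [|i IHi]; first by rewrite addn0 lcn1.
  (* ['L_0(P)] and ['L_1(P)] are both [P], so the commutator recursion needs [t > 0] made
     explicit. *)
  have [t' Dt] : exists t', t = t'.+1 by exists t.-1; rewrite prednK // ltnW.
  rewrite addnS Dt addSn lcnSn.
  apply: subset_trans (regular_commg_Mho1 pP regP (lcn_normal i.+1 P)).
  by rewrite commSg // -addSn -Dt.
have L1 : 'L_(t + c)(P) = 1.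
  apply/trivgP; apply: subset_trans (LM c) _.
  rewrite (Mho1_exponent (pgroupS (lcn_sub _ _) pP)) //.
  exact: dvdn_trans (exponentS LO) eO.
(* The class is at most [t + c - 1], and [t + c <= k + c <= f + 2]. *)
apply: leq_trans (_ : (t + c).-1 <= _); last first.
  by move: le_tk fQ; rewrite /c; clear; lia.
by apply/(lcn_nil_classP _ (pgroup_nil pP)); rewrite prednK // addn_gt0 ltnW.
Qed.

Theorem theorem1 (p : nat) (gT : finGroupType) (P : {group gT})
    (p_prime : prime p) (pP : (p.-group P)%g)
    (p_gt : coexponent p P + 1 < p) :
  nil_class P <= coexponent p P + 1.
Proof. exact: nil_class_coexponent p_prime pP (leqnn _) p_gt. Qed.
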